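(* Let $m$ be an even positive integer and let $n,r$ be positive integers. There exists an $SMR(m,n;r,2)$ if and only if either $m=2$ and $n=r\equiv 0$ or $3\pmod 4$, or $m\geq 4$, $r\geq 3$ and $mr=2n$.
   Context: A signed magic rectangle $SMR(m,n;r,s)$ is an $m\times n$ array, some of whose cells are filled with integers and the others empty, such that exactly $r$ cells in every row and exactly $s$ cells in every column are filled (so $mr=ns$), every element of $X$ appears exactly once in the array, and the sum of the entries of each row and of each column is zero, where (for $mr$ even) $X=\{\pm1,\pm2,\ldots,\pm mr/2\}$. *)

(* Defs.v *)
(* MathComp world *)
From mathcomp Require Import all_boot all_order all_algebra.
Set Implicit Arguments.
Unset Strict Implicit.
Unset Printing Implicit Defensive.
Import GRing.Theory.
Local Open Scope ring_scope.

(* The N symbols filling N cells: {±1, ..., ±N/2} when N is even and, by the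
   usual convention, {0, ±1, ..., ±(N-1)/2} when N is odd.  [`|x|%N] is the
   absolute value of x as a natural number. *)
Definition smr_symbol (N : nat) (x : int) : bool :=
  (`|x| <= N./2)%N && (odd N || (x != 0)).

(* [None] is an empty cell.  It contributes 0 to the row and column sums.
   Since r filled cells in each of the m rows make m * r = #|X| filled cells,
   the [smr_once] field also forces every entry to be a symbol. *)
Record is_SMR (m n r s : nat) (A : 'M[option int]_(m, n)) : Prop := IsSMR {
  smr_row_card : forall i : 'I_m, #|[set j : 'I_n | A i j != None]| = r;
  smr_col_card : forall j : 'I_n, #|[set i : 'I_m | A i j != None]| = s;
  smr_once : forall x : int, smr_symbol (m * r) x ->
    exists! p : 'I_m * 'I_n, A p.1 p.2 = Some x;
  smr_row_sum : forall i : 'I_m, \sum_(j < n) odflt 0 (A i j) = 0;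
  smr_col_sum : forall j : 'I_n, \sum_(i < m) odflt 0 (A i j) = 0
}.

Definition SMR_exists (m n r s : nat) : Prop :=
  exists A : 'M[option int]_(m, n), is_SMR r s A.

(* Main.v *)
Require Import Defs.
From mathcomp Require Import all_boot all_order all_algebra.
From mathcomp Require Import zify.
Set Implicit Arguments.
Unset Strict Implicit.
Unset Printing Implicit Defensive.
Import Order.TTheory GRing.Theory Num.Theory.
Local Open Scope ring_scope.

(** A column with two filled cells holds x and -x, so an SMR(m,n;r,2) amounts to
    a partition of {±1, ..., ±n} into m zero-sum rows of size r, none of which
    contains both x and -x.  For m = 2 the rows are opposite and exist iff
    1 + ... + n is even.  For m = 2q >= 4 the construction keeps exactly one
    entry of absolute value at most q, the head, in each row.  Rows of size 3
    come from a closed tour of 2q consecutive integers, made of two translated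
    graceful zigzags, whose jumps are ±1, ..., ±q; rows of size 4 are
    ±(e, -(q+e), -(2q+e), 3q+e).  To pass from r to r+2, replace the head h by h',
    the head of the next absolute value in cyclic order, and append
    N + h, -(N + h') with N = qr for h > 0 and N = -(qr + q) for h < 0. *)

(** * The symbols ±1, ..., ±n as a list *)

Definition symbols (n : nat) : seq int :=
  [seq (k.+1)%:Z | k <- iota 0 n] ++ [seq - (k.+1)%:Z | k <- iota 0 n].

Lemma size_symbols (n : nat) : size (symbols n) = n.*2.
Proof. by rewrite size_cat !size_map !size_iota addnn. Qed.

Lemma mem_symbols (n : nat) (x : int) : (x \in symbols n) = (0 < `|x| <= n)%N.
Proof.
rewrite mem_cat; apply/orP/idP => [[]/mapP[k]|x_bd].
- by rewrite mem_iota => ? ->; lia.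
- by rewrite mem_iota => ? ->; lia.
case: (lerP 0 x) => x0; [left|right]; apply/mapP; exists `|x|.-1;
  rewrite ?mem_iota; lia.
Qed.

Lemma symbols_uniq (n : nat) : uniq (symbols n).
Proof.
rewrite cat_uniq !map_inj_uniq ?iota_uniq ?andbT /=; try by move=> ? ?; lia.
by apply/hasPn => x /mapP[k _ ->]; apply/mapP => -[l _]; lia.
Qed.

Lemma big_symbols (M : nmodType) (n : nat) (f : int -> M) :
  \sum_(x <- symbols n) f x =
  \sum_(j < n) (f (j.+1)%:Z + f (- (j.+1)%:Z)).
Proof.
rewrite big_cat !big_map /= big_split /=.
rewrite -(big_mkord xpredT (fun j => f (j.+1)%:Z)).
by rewrite -(big_mkord xpredT (fun j => f (- (j.+1)%:Z))) /index_iota subn0.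
Qed.

Lemma smr_symbolE (m n r : nat) (x : int) : (m * r = 2 * n)%N ->
  smr_symbol (m * r) x = (x \in symbols n).
Proof. by move=> ->; rewrite /smr_symbol mem_symbols; lia. Qed.

(** Counting: [s] is no longer than the duplicate-free list it covers, so it has room neither for a
    repetition nor for a foreign element. *)
Lemma perm_symbols (n : nat) (s : seq int) : (size s <= n.*2)%N ->
  {subset symbols n <= s} -> perm_eq s (symbols n).
Proof.
rewrite -size_symbols => sz sub.
have [_ eqm] := uniq_min_size (symbols_uniq n) sub sz.
apply: uniq_perm (symbols_uniq n) _; last by move=> x; rewrite eqm.
exact: leq_size_uniq (symbols_uniq n) sub sz.
Qed.

(** * From zero-sum rows to an array *)

Section RowsToArray.
Variables (m n r : nat) (R : 'I_m -> seq int).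
Hypothesis mr2n : (m * r = 2 * n)%N.
Hypothesis size_R : forall i, size (R i) = r.
Hypothesis sum_R : forall i, \sum_(x <- R i) x = 0.
Hypothesis opp_R : forall i (x : int), x \in R i -> - x \notin R i.
Hypothesis cover_R : forall x : int, (0 < `|x| <= n)%N -> exists i, x \in R i.

Let entry (p : 'I_m * 'I_r) : int := nth 0 (R p.1) p.2.

(** The rows have mr = 2n positions and cover 2n symbols; the uniqueness facts below all come from
    this count. *)
Let perm_entries : perm_eq (codom entry) (symbols n).
Proof.
apply: perm_symbols => [|x]; first by rewrite size_codom card_prod !card_ord; lia.
rewrite mem_symbols => /cover_R[i xRi].
have lt_r : (index x (R i) < r)%N by rewrite -(size_R i) index_mem.
by apply/codomP; exists (i, Ordinal lt_r); rewrite /entry /= nth_index.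
Qed.

Let entry_inj : injective entry.
Proof.
by apply/injectiveP; rewrite /injectiveb /dinjectiveb (perm_uniq perm_entries)
  symbols_uniq.
Qed.

Let in_row (x : int) (i : 'I_m) : x \in R i -> exists t, x = entry (i, t).
Proof.
move=> xRi; have lt_r : (index x (R i) < r)%N by rewrite -(size_R i) index_mem.
by exists (Ordinal lt_r); rewrite /entry nth_index.
Qed.

Let row_inj (x : int) (i i' : 'I_m) : x \in R i -> x \in R i' -> i = i'.
Proof. by move=> /in_row[t ->] /in_row[t' /entry_inj[]]. Qed.

Let row_uniq (i : 'I_m) : uniq (R i).
Proof.
apply/(uniqP 0) => t t'; rewrite !inE !size_R => ltt ltt' e.
by have [] := @entry_inj (i, Ordinal ltt) (i, Ordinal ltt') e.
Qed.

Let row_sub (i : 'I_m) : {subset R i <= symbols n}.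
Proof.
by move=> x /in_row[t ->]; rewrite -(perm_mem perm_entries) codom_f.
Qed.

(** Indexing a row by columns serves both the cell count ([f] constant 1) and the row sum ([f] the
    identity). *)
Let big_row (M : nmodType) (f : int -> M) (i : 'I_m) :
  \sum_(x <- R i) f x = \sum_(j < n)
    ((if (j.+1)%:Z \in R i then f (j.+1)%:Z else 0)
     + (if - (j.+1)%:Z \in R i then f (- (j.+1)%:Z) else 0)).
Proof.
rewrite -(big_symbols n (fun x => if x \in R i then f x else 0)) -big_mkcond.
rewrite -big_filter; apply: perm_big; apply: uniq_perm => //.
  by rewrite filter_uniq ?symbols_uniq.
move=> x; rewrite mem_filter; apply/idP/idP => [xRi|/andP[]//].
by rewrite xRi (row_sub xRi).
Qed.

(** Column [j] is reserved for ±(j+1). By [opp_R] a row holds at most one of the two, so the order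
    of the tests is immaterial. *)
Let A : 'M[option int]_(m, n) := \matrix_(i, j)
  if (j.+1)%:Z \in R i then Some (j.+1)%:Z
  else if - (j.+1)%:Z \in R i then Some (- (j.+1)%:Z) else None.

Let A_Some i j x : A i j = Some x -> x \in R i /\ `|x|%N = j.+1.
Proof.
rewrite mxE; case: ifP => [? [<-]|_]; first by [].
by case: ifP => // ? [<-]; split=> //; lia.
Qed.

Let A_in i (j : 'I_n) (x : int) : x \in R i -> `|x|%N = j.+1 -> A i j = Some x.
Proof.
move=> xRi xj; rewrite mxE; have [x0|x0] := lerP 0 x.
  by rewrite (_ : (j.+1)%:Z = x) ?xRi //; lia.
rewrite (_ : (j.+1)%:Z = - x); last by lia.
by rewrite opprK xRi (negPf (opp_R xRi)).
Qed.

Let A_None i j : (A i j != None) = ((j.+1)%:Z \in R i) || (- (j.+1)%:Z \in R i).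
Proof. by rewrite mxE; do 2?case: ifP. Qed.

Let col_rows (j : 'I_n) : exists i1 i2, [/\ i1 != i2, A i1 j = Some (j.+1)%:Z,
  A i2 j = Some (- (j.+1)%:Z) & forall i, A i j != None -> (i == i1) || (i == i2)].
Proof.
have [|i1 R1] := @cover_R (j.+1)%:Z; first by have := ltn_ord j; lia.
have [|i2 R2] := @cover_R (- (j.+1)%:Z); first by have := ltn_ord j; lia.
exists i1, i2; split; try by apply: A_in => //; lia.
  by apply: contraTneq R2 => <-; apply: opp_R.
by move=> i; rewrite A_None => /orP[] iR; apply/orP; [left|right];
  apply/eqP; apply: row_inj iR _.
Qed.

Lemma SMR_of_rows : SMR_exists m n r 2.
Proof.
exists A; split.
- move=> i; rewrite cardsE -sum1_card -(size_R i) -sum1_size.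
  rewrite (big_row (fun=> 1%N)) big_mkcond /=; apply: eq_bigr => j _.
  rewrite unfold_in /= A_None; have := @opp_R i (j.+1)%:Z.
  by case: ((j.+1)%:Z \in R i) => [/(_ isT)/negPf->|_]; case: (- (j.+1)%:Z \in R i).
- move=> j; have [i1 [i2 [ni A1 A2 A12]]] := col_rows j.
  rewrite (_ : [set i | _] = [set i1; i2]) ?cards2 ?ni //.
  apply/setP => i; rewrite !inE; apply/idP/idP => [/A12//|].
  by case/orP => /eqP->; rewrite ?A1 ?A2.
- move=> x; rewrite (smr_symbolE _ mr2n) mem_symbols => x_bd.
  have [i xRi] := cover_R x_bd.
  have lt_n : (`|x|.-1 < n)%N by lia.
  exists (i, Ordinal lt_n); split=> [|[i' j'] /= /A_Some[xRi' xj']].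
    by apply: A_in => //=; lia.
  by rewrite (row_inj xRi xRi'); congr pair; apply: val_inj => /=; lia.
- move=> i; rewrite -[RHS](sum_R i) (big_row id); apply: eq_bigr => j _.
  rewrite mxE; have := @opp_R i (j.+1)%:Z.
  case: ((j.+1)%:Z \in R i) => [/(_ isT)/negPf->|_] /=; first by rewrite addr0.
  by case: (- (j.+1)%:Z \in R i); rewrite /= add0r.
- move=> j; have [i1 [i2 [ni A1 A2 A12]]] := col_rows j.
  rewrite (bigD1 i1) //= (bigD1 i2) 1?eq_sym //= A1 A2 big1 /=; first by lia.
  move=> i /andP[n1 n2]; apply: contraNeq n1 => Ai.
  have := A12 i; rewrite (negPf n2) orbF; apply.
  by apply: contraNneq Ai => ->.
Qed.

End RowsToArray.

(** * Row families with a distinguished head *)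

(** The invariant of the induction on [r]. As tails avoid ±1, ..., ±q, each of these 2q symbols is
    the head of exactly one of the 2q rows. *)
Record headed_rows (q r : nat) (R : nat -> seq int) : Prop := HeadedRows {
  hr_size : forall i, (i < q.*2)%N -> size (R i) = r;
  hr_sum : forall i, (i < q.*2)%N -> \sum_(x <- R i) x = 0;
  hr_opp : forall i (x : int), (i < q.*2)%N -> x \in R i -> - x \notin R i;
  hr_head : forall i, (i < q.*2)%N -> (0 < `|head (0 : int) (R i)| <= q)%N;
  hr_tail : forall i (x : int), (i < q.*2)%N -> x \in behead (R i) ->
    (q < `|x| <= q * r)%N;
  hr_cover : forall x : int, (0 < `|x| <= q * r)%N ->
    exists2 i, (i < q.*2)%N & x \in R i
}.

(** * Graceful zigzags and the closed tour *)

Definition zigzag (q i : nat) : nat :=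
  if odd i then (q - i./2.+1)%N else i./2.

(* The tour is q + z_0, ..., q + z_(q-1), z_(q-1), ..., z_0 with z = zigzag q. *)
Definition double_zigzag (q t : nat) : nat :=
  if (t < q)%N then (q + zigzag q t)%N else zigzag q (q.*2 - t.+1).

Definition next (q t : nat) : nat := if t.+1 == q.*2 then 0%N else t.+1.

Lemma zigzag_lt (q i : nat) : (i < q)%N -> (zigzag q i < q)%N.
Proof.
move=> lti; rewrite /zigzag; have := odd_double_half i; case: (odd i) => /=; lia.
Qed.

Lemma zigzag_onto (q w : nat) : (w < q)%N ->
  exists2 i, (i < q)%N & zigzag q i = w.
Proof.
move=> ltwq; rewrite /zigzag; case: (ltnP w.*2 q) => [lt2wq|leq2w].
  by exists w.*2 => //; rewrite odd_double doubleK.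
by exists (q - w.+1).*2.+1; rewrite ?oddS ?odd_double /= ?uphalf_double; lia.
Qed.

(** The sequence 0, q-1, 1, q-2, ... alternates between the two ends of the remaining interval,
    which shrinks by one at each step. *)
Lemma zigzag_step (q i : nat) : (i.+1 < q)%N ->
  `|((zigzag q i)%:Z - (zigzag q i.+1)%:Z)%R|%N = (q - i.+1)%N.
Proof.
move=> lti; rewrite /zigzag oddS; have := odd_double_half i.
have := uphalf_half i; case: (odd i) => /=; lia.
Qed.

Lemma double_zigzag_onto (q w : nat) : (w < q.*2)%N ->
  exists2 t, (t < q.*2)%N & double_zigzag q t = w.
Proof.
move=> ltw; case: (ltnP w q) => [ltwq|leqw].
  have [i ltiq <-] := zigzag_onto ltwq; exists (q.*2 - i.+1)%N; first by lia.
  by rewrite /double_zigzag ltnNge (_ : q <= _)%N /=; [congr zigzag|]; lia.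
have [i ltiq zi] : exists2 i, (i < q)%N & zigzag q i = (w - q)%N.
  by apply: zigzag_onto; lia.
by exists i; rewrite /double_zigzag ?ltiq ?zi; lia.
Qed.

Lemma next_onto (q t : nat) : (t < q.*2)%N ->
  exists2 s, (s < q.*2)%N & next q s = t.
Proof.
case: t => [|t] ltt; first by exists q.*2.-1; rewrite /next ?ifT; lia.
by exists t; rewrite /next ?ifN; lia.
Qed.

Lemma double_zigzag_lt (q t : nat) : (t < q.*2)%N -> (double_zigzag q t < q.*2)%N.
Proof.
rewrite /double_zigzag => ltt; case: ifP => ltq; last first.
  have := @zigzag_lt q (q.*2 - t.+1); lia.
have := @zigzag_lt q t; lia.
Qed.

Lemma next_lt (q t : nat) : (t < q.*2)%N -> (next q t < q.*2)%N.
Proof. by rewrite /next; case: ifP; lia. Qed.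

Definition jump (q t : nat) : int :=
  (double_zigzag q t)%:Z - (double_zigzag q (next q t))%:Z.

Lemma jump_up (q t : nat) : (t.+1 < q)%N ->
  jump q t = (zigzag q t)%:Z - (zigzag q t.+1)%:Z.
Proof.
move=> lttq; rewrite /jump /next ifN; last by lia.
rewrite /double_zigzag lttq ifT; lia.
Qed.

(** The second half of the tour retraces the zigzag backwards, which supplies the opposites of the
    jumps of the first half. *)
Lemma jump_down (q i : nat) : (i.+1 < q)%N ->
  jump q (q + (q - i.+2)) = (zigzag q i.+1)%:Z - (zigzag q i)%:Z.
Proof.
move=> ltiq; rewrite /jump /next ifN; last by lia.
rewrite /double_zigzag !ifN; try lia.
by congr ((zigzag q _)%:Z - (zigzag q _)%:Z); lia.
Qed.

(** Here the tour drops from the translated zigzag to the untranslated one at the same zigzag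
    value. *)
Lemma jump_mid (q : nat) : (0 < q)%N -> jump q q.-1 = q%:Z.
Proof.
move=> q_gt0; rewrite /jump /next ifN; last by lia.
rewrite prednK // /double_zigzag ltnn ifT; last by lia.
by rewrite (_ : q.*2 - q.+1 = q.-1)%N; lia.
Qed.

Lemma jump_last (q : nat) : (0 < q)%N -> jump q q.*2.-1 = - q%:Z.
Proof.
move=> q_gt0; rewrite /jump /next ifT; last by lia.
rewrite /double_zigzag q_gt0 ifN; last by lia.
by rewrite prednK ?subnn; lia.
Qed.

Lemma jump_bound (q t : nat) : (t < q.*2)%N -> (0 < `|jump q t| <= q)%N.
Proof.
move=> ltt; have q_gt0 : (0 < q)%N by lia.
have [ltq|] := ltnP t.+1 q.
  by rewrite jump_up //; have := zigzag_step ltq; lia.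
rewrite leq_eqVlt => /predU1P[tq|letq].
  by rewrite (_ : t = q.-1) ?jump_mid; lia.
have [ltt'|let'] := ltnP t.+1 q.*2; last first.
  by rewrite (_ : t = q.*2.-1) ?jump_last; lia.
have lti : ((q.*2 - t.+2).+1 < q)%N by lia.
rewrite (_ : t = q + (q - (q.*2 - t.+2).+2))%N; last by lia.
by rewrite jump_down //; have := zigzag_step lti; lia.
Qed.

Lemma jump_onto (q : nat) (x : int) : (0 < `|x| <= q)%N ->
  exists2 t, (t < q.*2)%N & jump q t = x.
Proof.
move=> x_bd; have [xq|xNq] := eqVneq `|x|%N q.
  have [x_ge0|x_lt0] := lerP 0 x.
    by exists q.-1; rewrite ?jump_mid; lia.
  by exists q.*2.-1; rewrite ?jump_last; lia.
(* The zigzag step of index q - |x| - 1 has length |x|; the sign of [x] then selects this step or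
   its retrace. *)
have ltiq : ((q - `|x|.+1).+1 < q)%N by lia.
have := zigzag_step ltiq; set u := (_ - _)%R => absu.
have [xu|xu] : x = u \/ x = - u by lia.
  exists (q - `|x|.+1)%N; first by lia.
  by rewrite jump_up.
exists (q + (q - (q - `|x|.+1).+2))%N; first by lia.
by rewrite jump_down // [RHS]xu opprB.
Qed.

(** * Base families: rows of size 3 and 4 *)

Definition rows3 (q t : nat) : seq int :=
  [:: jump q t; (q + double_zigzag q (next q t)).+1%:Z;
      - (q + double_zigzag q t).+1%:Z].

(** The jump cancels the difference of the two tail entries. The closed tour reaches and leaves each
    label, so every absolute value from q+1 to 3q occurs with both signs; nonzero jumps keep
    opposites out of a row. *)
Lemma headed_rows3 (q : nat) : headed_rows q 3 (rows3 q).
Proof.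
split=> [i _|i ltt|i x ltt|i ltt|i x ltt|x] //.
- rewrite /rows3 /jump !big_cons big_nil; lia.
- rewrite /rows3 !inE; have := jump_bound ltt; rewrite /jump; lia.
- exact: jump_bound.
- rewrite /rows3 /= !inE; have := double_zigzag_lt ltt.
  have := double_zigzag_lt (next_lt ltt); lia.
- move=> /andP[x_gt0 le_x].
  case: (leqP `|x|%N q) => [lexq|ltqx].
    have [|t ltt tE] := @jump_onto q x; first by lia.
    by exists t; rewrite // /rows3 inE tE eqxx.
  have [|t ltt tE] := @double_zigzag_onto q (`|x| - q.+1); first by lia.
  case: (lerP 0 x) => [x_pos|x_neg].
    have [s lts sE] := next_onto ltt.
    exists s => //; rewrite /rows3 !inE sE tE; lia.
  exists t => //; rewrite /rows3 !inE tE; lia.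
Qed.

Definition rows4 (q i : nat) : seq int :=
  if (i < q)%N
  then [:: i.+1%:Z; - (q + i.+1)%:Z; - (q.*2 + i.+1)%:Z; (q.*2 + q + i.+1)%:Z]
  else [:: - (i - q).+1%:Z; (i.+1)%:Z; (q + i.+1)%:Z; - (q.*2 + i.+1)%:Z].

Lemma headed_rows4 (q : nat) : headed_rows q 4 (rows4 q).
Proof.
split=> [i lti|i lti|i x lti|i lti|i x lti|x lex]; rewrite /rows4;
  try by (case: ifP => ltiq; rewrite /= ?inE ?big_cons ?big_nil; lia).
(* [w] is the position of |x| in its block of q consecutive absolute values; [x] lies in row [w] or
   in its negative, row q+w. *)
have [w ltwq] : exists2 w, (w < q)%N & `|x|%N \in
    [:: w.+1; q + w.+1; q.*2 + w.+1; q.*2 + q + w.+1]%N.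
  have [le1|gt1] := leqP `|x|%N q; first by exists `|x|.-1; rewrite ?inE; lia.
  have [le2|gt2] := leqP `|x|%N q.*2.
    by exists (`|x| - q.+1)%N; rewrite ?inE; lia.
  have [le3|gt3] := leqP `|x|%N (q.*2 + q).
    by exists (`|x| - q.*2.+1)%N; rewrite ?inE; lia.
  by exists (`|x| - (q.*2 + q).+1)%N; rewrite ?inE; lia.
rewrite !inE => xw.
have [xin|xin] : x \in rows4 q w \/ x \in rows4 q (q + w).
- rewrite /rows4 ltwq ltnNge leq_addr /= !inE; lia.
- by exists w; [lia|].
- by exists (q + w)%N; [lia|].
Qed.

(** * Lengthening the rows by two *)

Definition rotate_abs (q : nat) (h : int) : int :=
  if 0 <= h then (`|h| %% q).+1%:Z else - (`|h| %% q).+1%:Z.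

Lemma rotate_abs_bound (q : nat) (h : int) : (0 < `|h| <= q)%N ->
  (0 < `|rotate_abs q h| <= q)%N.
Proof.
move=> h_bd; have /(ltn_pmod `|h|) : (0 < q)%N by lia.
by rewrite /rotate_abs; case: ifP => _; lia.
Qed.

(** The rotation 1, 2, ..., q, 1 has no fixed point; a fixed head would make the two appended
    entries opposite. *)
Lemma rotate_abs_neq (q : nat) (h : int) : (1 < q)%N -> (0 < `|h| <= q)%N ->
  `|rotate_abs q h|%N != `|h|%N.
Proof.
move=> q_gt1 h_bd; rewrite /rotate_abs; have [hq|h_lt] := eqVneq `|h|%N q.
  by rewrite hq modnn; case: ifP; lia.
by rewrite modn_small; [case: ifP|]; lia.
Qed.

Lemma rotate_abs_onto (q : nat) (x : int) : (0 < `|x| <= q)%N ->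
  exists2 h : int, (0 < `|h| <= q)%N & rotate_abs q h = x.
Proof.
move=> x_bd; pose k := if `|x|%N == 1%N then q else `|x|.-1.
have k_bd : (0 < k <= q)%N by rewrite /k; case: ifP; lia.
have kx : (k %% q).+1 = `|x|%N.
  rewrite /k; case: eqP => [->|xN1]; first by rewrite modnn.
  by rewrite modn_small; lia.
have [x_ge0|x_lt0] := lerP 0 x.
  by exists k%:Z; rewrite // /rotate_abs /= kx; lia.
exists (- k%:Z); first by lia.
rewrite /rotate_abs ifF; last by lia.
by rewrite (_ : `|- k%:Z|%N = k) ?kx; lia.
Qed.

Lemma rotate_abs_sign (q : nat) (h : int) : (0 < `|h|)%N ->
  (0 <= rotate_abs q h) = (0 <= h).
Proof. by rewrite /rotate_abs; case: ifP; lia. Qed.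

(** Adding the offset sends positive heads to absolute values n+1, ..., n+q and negative ones to
    n+q+1, ..., n+2q. *)
Definition offset (q n : nat) (h : int) : int :=
  if 0 <= h then n%:Z else - (n + q)%:Z.

Definition extend_row (q n : nat) (s : seq int) : seq int :=
  let h := head 0 s in let h' := rotate_abs q h in let N := offset q n h in
  [:: h', N + h, - (N + h') & behead s].

(** The three new entries add up to the old head, so row sums persist. Both h and h' run over ±1,
    ..., ±q, so each N + h occurs in some row and its opposite in another. *)
Lemma extend_headed_rows (q r : nat) (R : nat -> seq int) : (1 < q)%N ->
  (0 < r)%N -> headed_rows q r R ->
  headed_rows q r.+2 (fun i => extend_row q (q * r) (R i)).
Proof.
move=> q_gt1 r_gt0 [sz sum0 opp hd tl cov].
have RE i : (i < q.*2)%N -> R i = head (0 : int) (R i) :: behead (R i).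
  by move=> lti; case: (R i) (sz i lti) r_gt0 => //= <-.
have hd_of (x : int) : (0 < `|x| <= q)%N ->
    exists2 i, (i < q.*2)%N & head 0 (R i) = x.
  move=> x_bd; have [|i lti] := @cov x; first by nia.
  rewrite RE // inE => /predU1P[->|/(tl _ _ lti)]; first by exists i.
  lia.
have bigN (i : nat) (h := head (0 : int) (R i)) (N := offset q (q * r) h) :
    (i < q.*2)%N -> [/\ (q * r < `|(N + h)%R| <= q * r.+2)%N,
      (q * r < `|(N + rotate_abs q h)%R| <= q * r.+2)%N
    & `|(N + h)%R|%N != `|(N + rotate_abs q h)%R|%N].
  move=> lti; have h_bd := hd _ lti; rewrite -/h in h_bd.
  have := rotate_abs_bound h_bd; have := rotate_abs_neq q_gt1 h_bd.
  have := rotate_abs_sign q (proj1 (andP h_bd)).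
  rewrite /N /offset !mulnS; case: (lerP 0 h); split; lia.
split=> [i lti|i lti|i x lti|i lti|i x lti|x x_bd].
- by have := sz i lti; rewrite (RE i lti) /= => ->.
- have := sum0 i lti; rewrite (RE i lti) /extend_row /= !big_cons; lia.
- have [b1 b2 b3] := bigN i lti; have h_bd := hd i lti.
  have := rotate_abs_bound h_bd; have tli := tl i; have oppi := opp i.
  rewrite /extend_row; move: b1 b2 b3.
  set N := offset _ _ _; set h := head _ _; set h' := rotate_abs _ _.
  (* Head, old tail and appended entries have absolute values in disjoint ranges, so opposites could
     only meet inside the old tail (excluded by [opp]) or between the two appended entries (excluded
     by [b3]). *)
  move=> b1 b2 b3 h'_bd xin; apply/negP; move: xin; rewrite !inE => xin oxin.
  have [xt|xnt] := boolP (x \in behead (R i)).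
    have := tli _ lti xt.
    have [oxt|oxnt] := boolP (- x \in behead (R i)).
      by have := opp i x lti; rewrite (RE i lti) !inE xt oxt !orbT => /(_ isT).
    move: oxin; rewrite (negPf oxnt) => oxin; nia.
  move: xin; rewrite (negPf xnt) => xin.
  have [oxt|oxnt] := boolP (- x \in behead (R i)).
    have := tli _ lti oxt; nia.
  move: oxin; rewrite (negPf oxnt) => oxin; nia.
- exact: rotate_abs_bound (hd _ lti).
- have [b1 b2 b3] := bigN i lti; rewrite /= !inE.
  case/or3P => [/eqP->|/eqP->|/(tl _ _ lti)]; nia.
- have [lexq|ltqx] := leqP `|x|%N q.
    have [|h h_bd hx] := @rotate_abs_onto q x; first by lia.
    have [i lti ih] := hd_of h h_bd.
    by exists i; rewrite // /extend_row ih hx inE eqxx.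
  have [lexn|ltnx] := leqP `|x|%N (q * r)%N.
    have [|i lti xi] := cov x; first by lia.
    exists i; rewrite // !inE; move: xi; rewrite (RE i lti) inE => /predU1P[xh|->].
      by have := hd i lti; rewrite -xh; lia.
    by rewrite !orbT.
  rewrite !mulnS in x_bd.
  (* The half of the new range containing |x| fixes the sign of the head; the sign of [x] then
     decides between N + h and -(N + h). *)
  have [[h h_bd ->]|[h' h'_bd ->]] :
    (exists2 h : int, (0 < `|h| <= q)%N & x = offset q (q * r) h + h)
    \/ (exists2 h : int, (0 < `|h| <= q)%N & x = - (offset q (q * r) h + h)).
    rewrite /offset.
    have [x_ge0|x_lt0] := lerP 0 x; have [le1|lt1] := leqP `|x|%N (q * r + q).
    + by left; exists (x - (q * r)%:Z); rewrite ?ifT; lia.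
    + by right; exists (- (x - (q * r + q)%:Z)); rewrite ?ifF; lia.
    + by right; exists (- x - (q * r)%:Z); rewrite ?ifT; lia.
    + by left; exists (x + (q * r + q)%:Z); rewrite ?ifF; lia.
  + have [i lti <-] := hd_of h h_bd.
    by exists i; rewrite // /extend_row !inE eqxx !orbT.
  + have [h h_bd <-] := rotate_abs_onto h'_bd.
    (* The rotation keeps signs, so h and h' have the same offset. *)
    rewrite /offset rotate_abs_sign -/(offset q (q * r) h); last by lia.
    have [i lti <-] := hd_of h h_bd.
    by exists i; rewrite // /extend_row !inE eqxx !orbT.
Qed.

Lemma headed_rows_exist (q r : nat) : (1 < q)%N -> (2 < r)%N ->
  exists R, headed_rows q r R.
Proof.
move=> q_gt1; have [n] := ubnP r; elim: n r => // n IHn r ltrn r_gt2.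
have [->|r3] := eqVneq r 3%N; first by exists (rows3 q); apply: headed_rows3.
have [->|r4] := eqVneq r 4%N; first by exists (rows4 q); apply: headed_rows4.
have [||R hR] := IHn r.-2; try lia.
have -> : r = r.-2.+2 by lia.
by eexists; apply: extend_headed_rows hR; lia.
Qed.

(** * Necessary conditions when columns have two filled cells *)

Section ArrayOfWeightTwo.
Variables (m n r : nat) (A : 'M[option int]_(m, n)).
Hypothesis smrA : is_SMR r 2 A.

Definition filled : {set 'I_m * 'I_n} := [set p | A p.1 p.2 != None].

Lemma card_filled_rows : #|filled| = (m * r)%N.
Proof.
rewrite -sum1_card (eq_bigl (fun p => A p.1 p.2 != None)); last first.
  by move=> p; rewrite inE.
rewrite -(pair_big_dep xpredT (fun i j => A i j != None) (fun _ _ => 1%N)) /=.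
rewrite (eq_bigr (fun=> r)) ?sum_nat_const ?card_ord // => i _.
by rewrite -(smr_row_card smrA i) -sum1_card; apply: eq_bigl => j; rewrite inE.
Qed.

Lemma card_filled_cols : #|filled| = (n * 2)%N.
Proof.
rewrite -sum1_card (eq_bigl (fun p => A p.1 p.2 != None)); last first.
  by move=> p; rewrite inE.
rewrite -(pair_big_dep xpredT (fun i j => A i j != None) (fun _ _ => 1%N)) /=.
rewrite (exchange_big_dep xpredT) //=.
rewrite (eq_bigr (fun=> 2%N)) ?sum_nat_const ?card_ord // => j _.
by rewrite -(smr_col_card smrA j) -sum1_card; apply: eq_bigl => i; rewrite inE.
Qed.

Lemma SMR2_size : (m * r = 2 * n)%N.
Proof. by rewrite -card_filled_rows card_filled_cols mulnC. Qed.

(** The 2n filled cells must accommodate all 2n symbols, so nothing else, in particular no 0, is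
    entered. *)
Lemma perm_filled :
  perm_eq [seq odflt 0 (A p.1 p.2) | p <- enum filled] (symbols n).
Proof.
apply: perm_symbols.
  by rewrite size_map -cardE card_filled_cols muln2.
move=> x; rewrite -(smr_symbolE x SMR2_size) => /(smr_once smrA)[[i j] [Aij _]].
by apply/mapP; exists (i, j); rewrite ?mem_enum ?inE /= Aij.
Qed.

Lemma entry_symbol i j x : A i j = Some x -> x \in symbols n.
Proof.
move=> Aij; rewrite -(perm_mem perm_filled); apply/mapP.
by exists (i, j); rewrite ?mem_enum ?inE /= Aij.
Qed.

Lemma entry_unique i j i' j' x : A i j = Some x -> A i' j' = Some x ->
  (i = i') /\ (j = j').
Proof.
move=> Aij Aij'; have := entry_symbol Aij.
rewrite -(smr_symbolE x SMR2_size) => /(smr_once smrA)[p [_ pU]].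
by have := pU (i, j) Aij; rewrite (pU (i', j') Aij') => -[-> ->].
Qed.

Lemma col_opp i j x : A i j = Some x -> exists2 i', i' != i & A i' j = Some (- x).
Proof.
move=> Aij; have /eqP/cards2P[i1 [i2 [ni E]]] := smr_col_card smrA j.
have memE i' : (A i' j != None) = (i' \in [set i1; i2]) by rewrite -E inE.
wlog e : i1 i2 ni {E} memE / i = i1 => [H|].
  have := memE i; rewrite Aij /= => /esym; rewrite !inE => /orP[] /eqP e.
    exact: (H i1 i2 ni memE e).
  apply: (H i2 i1) => //; first by rewrite eq_sym.
  by move=> i'; rewrite memE setUC.
exists i2; first by rewrite e eq_sym.
have := smr_col_sum smrA j; rewrite (bigD1 i1) //= (bigD1 i2) 1?eq_sym //=.
rewrite -e Aij big1 => [|k /andP[k1 k2]].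
  have := memE i2; rewrite !inE eqxx orbT; case: (A i2 j) => //= y _ s0.
  by congr Some; lia.
by have := memE k; rewrite !inE -e (negPf k1) (negPf k2); case: (A k j).
Qed.

(** A row with at most two entries, one of them x, would need x = 0 or also contain -x; but -x
    already sits in another row of the column of x. *)
Lemma SMR2_row_ge3 : (0 < m)%N -> (0 < r)%N -> (2 < r)%N.
Proof.
move=> m_gt0 r_gt0; rewrite ltnNge; apply/negP => le_r2.
pose i : 'I_m := Ordinal m_gt0.
have card_i := smr_row_card smrA i; have sum_i := smr_row_sum smrA i.
have [j Aij] : exists j, A i j != None.
  have /card_gt0P[j] : (0 < #|[set j | A i j != None]|)%N by rewrite card_i.
  by rewrite inE; exists j.
case Ex : (A i j) Aij => [x|//] _.
have x_sym := entry_symbol Ex; rewrite mem_symbols in x_sym.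
have [i' ni' Eox] := col_opp Ex.
have [x0|[k nkj Ek]] : x = 0 \/ exists2 k, k != j & A i k = Some (- x).
- move: sum_i; rewrite (bigD1 j) //= Ex /=.
  case: (pickP [pred k | (k != j) && (A i k != None)])
    => [k /= /andP[nkj Aik]|none].
    rewrite (bigD1 k) //= big1 => [|l /andP[nlj nlk]].
      case Ek: (A i k) Aik => [y|//] _ /= s0; right; exists k => //.
      by rewrite Ek; congr Some; lia.
    case El : (A i l) => [y|//].
    have : (3 <= #|[set j | A i j != None]|)%N.
      have <- : #|[set j; k; l]| = 3%N.
        rewrite -setUA cardsU1 cards2 !inE negb_or eq_sym nkj.
        by rewrite (eq_sym j) nlj (eq_sym k) nlk.
      apply/subset_leq_card/subsetP => t; rewrite !inE => /orP[/orP[]|] /eqP->;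
      by rewrite ?Ex ?El.
    by rewrite card_i; lia.
  rewrite big1 => [|l nlj]; first by rewrite addr0; left.
  by have := none l; rewrite /= nlj /=; case: (A i l).
- lia.
- by have [ii' _] := entry_unique Ek Eox; rewrite ii' eqxx in ni'.
Qed.

End ArrayOfWeightTwo.

(** * Arrays with two rows *)

(** Signs + - - + repeat with period 4; the phase c = 1 drops the first +, so that the sequence
    opens with -1 - 2 + 3 = 0. *)
Definition signed (c k : nat) : int :=
  if ((c + k) %% 4 \in [:: 1; 2])%N then - (k.+1)%:Z else (k.+1)%:Z.

Lemma abs_signed (c k : nat) : `|signed c k|%N = k.+1.
Proof. by rewrite /signed; case: ifP. Qed.

Lemma sum_signed4 (c n : nat) : (c + n = 0 %[mod 4])%N ->
  \sum_(k < n) signed c k = 0 -> \sum_(k < n.+4) signed c k = 0.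
Proof.
move=> cn sum0; rewrite !big_ord_recr /= sum0 /signed !inE.
have -> : ((c + n) %% 4 = 0)%N by lia.
have -> : ((c + n.+1) %% 4 = 1)%N by lia.
have -> : ((c + n.+2) %% 4 = 2)%N by lia.
have -> : ((c + n.+3) %% 4 = 3)%N by lia.
by rewrite /=; lia.
Qed.

Lemma sum_signed (n : nat) : (n = 0 %[mod 4] \/ n = 3 %[mod 4])%N ->
  \sum_(k < n) signed (odd n) k = 0.
Proof.
case=> n_mod.
  have [-> ->] : nat_of_bool (odd n) = 0%N /\ n = (n %/ 4 * 4)%N by lia.
  elim: (n %/ 4)%N => [|t IHt]; first by rewrite big_ord0.
  by rewrite mulSn; apply: sum_signed4; first by lia.
have [-> ->] : nat_of_bool (odd n) = 1%N /\ n = (n %/ 4 * 4 + 3)%N by lia.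
elim: (n %/ 4)%N => [|t IHt]; first by rewrite !big_ord_recr big_ord0.
by rewrite mulSn -addnA; apply: sum_signed4; first by lia.
Qed.

(** One row takes a signed copy of 1, ..., n with sum zero, the other row its negative. *)
Lemma SMR_two_rows (n : nat) : (n = 0 %[mod 4] \/ n = 3 %[mod 4])%N ->
  SMR_exists 2 n n 2.
Proof.
move=> n_mod; pose s := mkseq (signed (odd n)) n.
pose R (i : 'I_2) := if i == 0 then s else map -%R s.
have s_opp (x : int) : x \in s -> - x \notin s.
  move=> /mapP[k _ xk]; apply/mapP => -[l _ xl].
  have := abs_signed (odd n) k; have := abs_signed (odd n) l.
  rewrite -xk -xl abszN => -> [kl]; rewrite kl -xk in xl.
  have := abs_signed (odd n) k; lia.
have sum_s : \sum_(x <- s) x = 0.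
  have := sum_signed n_mod; rewrite -(big_mkord xpredT (signed (odd n))).
  by rewrite big_map /index_iota subn0.
apply: (@SMR_of_rows 2 n n R) => //.
- by move=> i; rewrite /R; case: ifP; rewrite ?size_map ?size_iota.
- by move=> i; rewrite /R; case: ifP => // _; rewrite big_map sumrN sum_s oppr0.
- move=> i x; rewrite /R; case: ifP => _; first exact: s_opp.
  move=> /mapP[y ys ->]; apply/mapP => -[z zs] /oppr_inj e.
  by have := s_opp y ys; rewrite e zs.
- move=> x x_bd; have sx : signed (odd n) `|x|.-1 \in s.
    by apply: map_f; rewrite mem_iota; lia.
  have [xs|xs] : signed (odd n) `|x|.-1 = x \/ signed (odd n) `|x|.-1 = - x.
    by have := abs_signed (odd n) `|x|.-1; lia.
  + by exists 0; rewrite /R eqxx -xs.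
  + by exists 1; rewrite /R /= -[x]opprK -xs map_f.
Qed.

Lemma odd_sum_abs (I : Type) (s : seq I) (f : I -> int) :
  odd (\sum_(i <- s) absz (f i))%N = odd `|(\sum_(i <- s) f i)%R|%N.
Proof.
by apply: (big_ind2 (fun a (b : int) => odd a = odd `|b|%N)) => // a b c d; lia.
Qed.

(** All absolute values add up to n(n+1). The two rows share this total equally, and each share is
    even since its row sums to 0; hence 4 divides n(n+1). *)
Lemma SMR2_two_rows_mod (n r : nat) (A : 'M[option int]_(2, n)) : is_SMR r 2 A ->
  (n = 0 %[mod 4] \/ n = 3 %[mod 4])%N.
Proof.
move=> smrA; pose v i j := odflt 0 (A i j).
have sumE : (\sum_(p : 'I_2 * 'I_n) absz (v p.1 p.2) = n * n.+1)%N.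
  transitivity (\sum_(x <- symbols n) absz x)%N.
    rewrite -(perm_big _ (perm_filled smrA)) big_map big_enum /= [RHS]big_mkcond /=.
    apply: eq_bigr => p _; rewrite inE /v.
    by case: (A p.1 p.2).
  rewrite (big_symbols n (fun x : int => `|x|%N)) /=.
  have -> : (n * n.+1 = n.+1 * n.+1.-1)%N by rewrite mulnC.
  elim: n {A smrA v} => [|k IHk]; first by rewrite big_ord0.
  rewrite big_ord_recr /= IHk; lia.
rewrite -(pair_bigA _ (fun i j => `|v i j|%N)) /= big_ord_recl big_ord1 in sumE.
have row_eq : (\sum_(j < n) absz (v ord0 j)
    = \sum_(j < n) absz (v (lift ord0 ord0) j))%N.
  (* The two entries of a column are opposite. *)
  apply: eq_bigr => j _; have := smr_col_sum smrA j.
  rewrite big_ord_recl big_ord1 /v; lia.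
have := odd_sum_abs (index_enum 'I_n) (v ord0).
rewrite (smr_row_sum smrA ord0) /= => ev.
move: sumE; rewrite -row_eq; set w := (\sum_(j < n) _)%N in ev *.
move=> e; have : ((n * n.+1) %% 4 = 0)%N.
  by rewrite -e; lia.
rewrite -modnMm -[n.+1]addn1 -modnDml; have := ltn_pmod n (isT : (0 < 4)%N).
by case: (n %% 4)%N => [|[|[|[|k]]]] //= _ _; [left|right].
Qed.

Local Close Scope ring_scope.

Theorem theorem21 (m n r : nat) (m_gt0 : 0 < m) (m_even : ~~ odd m)
    (n_gt0 : 0 < n) (r_gt0 : 0 < r) :
  SMR_exists m n r 2 <->
  (m = 2 /\ n = r /\ (n = 0 %[mod 4] \/ n = 3 %[mod 4]))
  \/ (4 <= m /\ 3 <= r /\ m * r = 2 * n).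
Proof.
split=> [[A smrA]|[[-> [<- n_mod]]|[m_ge4 [r_ge3 mr2n]]]].
- have mr2n := SMR2_size smrA; have r_ge3 := SMR2_row_ge3 smrA m_gt0 r_gt0.
  have [m2|m_neq2] := eqVneq m 2; last by right; split; [|split]; lia.
  subst m; left; split=> //; split; first by lia.
  exact: SMR2_two_rows_mod smrA.
- exact: SMR_two_rows.
(* With q = m/2 the family has 2q = m rows and covers absolute values up to qr = n. *)
- have [||R [R_size R_sum R_opp _ _ R_cover]] := @headed_rows_exist m./2 r; try lia.
  have m2 : m./2.*2 = m by lia.
  have ltm (i : 'I_m) : i < m./2.*2 by rewrite m2.
  apply: (@SMR_of_rows m n r (fun i => R i)) => //.
  + by move=> i; apply: R_size.
  + by move=> i; apply: R_sum.
  + by move=> i x; apply: R_opp.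
  + move=> x x_bd; have [|i] := R_cover x; first by nia.
    by rewrite m2 => lt_im xi; exists (Ordinal lt_im).
Qed.
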